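(* Let $X$ be a real Banach space, $\partial$ a subdifferential on $X$ (in the sense defined in the context), $\Omega\subset X$ a nonempty open convex subset, and $f:X\to\,]-\infty,+\infty]$ a lower semicontinuous function with $\Omega\cap\operatorname{dom} f\ne\emptyset$. If $f$ is $\partial$-subdifferentially and directionally stable (sds) on $\Omega$, then for every $\bar x\in\Omega\cap\operatorname{dom}\partial f$, every $u\in X$ with $\bar x+u\in\Omega\cap\operatorname{dom} f$ and every $t\in[0,1[$, the function $f$ is strictly upper semismooth at $\bar x+tu$ in the direction $u$ and its radial subderivative $f^r(\bar x+tu;u)$ is finite.
   Context: $X$ is a real Banach space, $X^*$ its topological dual, $\langle\cdot,\cdot\rangle$ the duality pairing; $[x,y[\,=\{x+t(y-x):t\in[0,1[\}$. For $f:X\to\,]-\infty,+\infty]$, $\operatorname{dom} f=\{x: f(x)<+\infty\}$; $f$ is proper if $\operatorname{dom} f\ne\emptyset$; lsc means lower semicontinuous. Subderivatives: for lsc $f$, $x\in\operatorname{dom} f$, $u\in X$, $$f^r(x;u)=\liminf_{t\searrow0}\frac{f(x+tu)-f(x)}{t},\qquad f^\uparrow(x;u)=\sup_{\delta>0}\ \limsup_{t\searrow 0,\ (y,f(y))\to(x,f(x))}\ \inf_{u'\in B_\delta(u)}\frac{f(y+tu')-f(y)}{t},$$ with values in $[-\infty,+\infty]$, where $B_\delta(u)$ is the ball of center $u$ and radius $\delta$. Subdifferentials: for $x\in\operatorname{dom} f$ let $\partial_{MR}f(x)=\{x^*\in X^*:\langle x^*,y-x\rangle+f(x)\le f(y)\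 \forall y\in X\}$ and $\partial_C f(x)=\{x^*\in X^*:\langle x^*,v\rangle\le f^\uparrow(x;v)\ \forall v\in X\}$; all subdifferentials are empty at points outside $\operatorname{dom} f$. A subdifferential on $X$ is any operator $\partial$ that associates to each proper lsc $f:X\to\,]-\infty,+\infty]$ a set-valued mapping $\partial f:X\rightrightarrows X^*$ (identified with its graph in $X\times X^*$) such that $\partial_{MR}f(x)\subset\partial f(x)\subset\partial_Cf(x)$ for all $x$ and the following Separation Principle holds: for any lsc $f,\varphi$ with $\varphi$ convex Lipschitz near $\bar x\in\operatorname{dom} f$, if $f+\varphi$ has a local minimum at $\bar x$, then $0\in\widehat\partial f(\bar x)+\partial\varphi(\bar x)$, where $\widehat\partial f(\bar x)$ is the set of $\bar x^*\in X^*$ for which there is a net $((x_\nu,x_\nu^* ))_\nu\subset\partial f$ with $(x_\nu,f(x_\nu))\to(\bar x,f(\bar x))$, $x_\nu^*\to\bar x^*$ in the weak-star topology, and $\limsup_\nu\langle x^*_\nu,x_\nu-\bar x\rangle\le0$. Write $\operatorname{dom}\partial f=\{x:\partial f(x)\neq\emptyset\}$. sds functions: a lsc $g:X\to\,]-\infty,+\infty]$ is $\partial$-subdifferentially and directionally stable (sds) on $\Omega$ if for every $u\in\Omega\cap\operatorname{dom}\partial g$ and $v\in\Omega\cap\operatorname{dom} g$ with $v\ne u$: (i) the function $t\mapsto\gamma(t):=g(u+t(v-u))$ is finite and continuous on $[0,1]$; (ii) for any $t\in[0,1[$, the right derivative $\gamma'_+(t)$ exists (in $[-\infty,+\infty]$)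 and is less than $+\infty$; (iii) for each $y\in[u,v[$ and each real $\varepsilon>0$ there is $r_0\in\,]0,1[$ such that for any $w=y+r(v-u)$ with $r\in\,]0,r_0]$ and every sequence $(x_n,x_n^* )\in\partial g$ with $x_n\to x_0\in[y,w[$ one has $$\limsup_{n\to\infty}\langle x_n^*,w-x_n\rangle\le g^r(y;w-x_0)+\varepsilon\|w-x_0\|.$$ $\limsup_{x\to\bar x}F(x)$, for $F$ defined on $\operatorname{dom} f$, is the supremum of $\limsup_nF(x_n)$ over all sequences $x_n\to\bar x$ in $\operatorname{dom} f$ ($x_n=\bar x$ allowed). $f$ is strictly upper semismooth at $\bar x\in\operatorname{dom} f$ in the direction $u$ if $\inf_{\alpha\ge0}\limsup_{x\to\bar x}f^r(x;u+\alpha(\bar x-x))\le f^r(\bar x;u)$. *)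

(* Defs.v *)
From mathcomp Require Import all_boot all_order all_algebra.
From mathcomp Require Import all_classical all_reals all_analysis.

Set Implicit Arguments.
Unset Strict Implicit.
Unset Printing Implicit Defensive.

Import Order.TTheory GRing.Theory Num.Theory.
Import numFieldNormedType.Exports.

Local Open Scope classical_set_scope.
Local Open Scope ring_scope.
Local Open Scope ereal_scope.

Record topdual (R : realType) (X : normedModType R) := Topdual {
  topdual_linear :> {linear X -> R^o} ;
  topdual_continuous : continuous topdual_linear
}.

Section defs.
Context (R : realType) (X : completeNormedModType R).
Implicit Types (f g phi : X -> \bar R) (x y u v w : X) (xs : topdual X).

(** Functions into ]-oo, +oo] are functions into [\bar R] avoiding [-oo]. *)
Definition lsc f := (forall x, f x != -oo) /\ lower_semicontinuous f.

Definition dom f : set X := [set x | f x < +oo].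

Definition proper f := dom f !=set0.

(** [x, y[ *)
Definition segment_co x y : set X :=
  [set (x + t *: (y - x))%R | t in `[0%R, 1%R[%classic].

(** The difference quotient (f (x + t u) - f x) / t; it is only meaningful for
    x in [dom f] and t > 0, where no indeterminate form can occur. *)
Definition quotient f x u (t : R) : \bar R :=
  (f (x + t *: u)%R - f x) * (t^-1)%:E.

Definition radial_subderivative f x u : \bar R :=
  limf_einf (quotient f x u) 0^'+.

(** The filter "(y, f y) --> (x, f x)" on y; when f x is finite, f y is finite
    eventually along it. *)
Definition attentive_nbhs f x : set_system X :=
  filter_from (nbhs (x, f x)) (fun U => [set y | U (y, f y)]).

(** The Rockafellar (upper) subderivative. *)
Definition upper_subderivative f x u : \bar R :=
  ereal_sup [set limf_esup
      (fun p : R * X => ereal_inf [set quotient f p.2 u' p.1 | u' in ball u delta])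
      (filter_prod 0^'+ (attentive_nbhs f x))
    | delta in [set delta : R | (0 < delta)%R]].

Definition subdiff_MR f x : set (topdual X) :=
  [set xs | dom f x /\ forall y, (xs (y - x)%R)%:E + f x <= f y].

Definition subdiff_C f x : set (topdual X) :=
  [set xs | dom f x /\ forall v, (xs v)%:E <= upper_subderivative f x v].

(** A candidate subdifferential; its values at functions that are not proper
    lsc are irrelevant. *)
Definition subdiff_operator := (X -> \bar R) -> X -> set (topdual X).

Implicit Type d : subdiff_operator.

Definition dom_subdiff d f : set X := [set x | d f x !=set0].

Definition directed (I : Type) (le : I -> I -> Prop) :=
  [/\ inhabited I, (forall i, le i i),
      (forall i j k, le i j -> le j k -> le i k) &
      (forall i j, exists k, le i k /\ le j k)].

Definition tails (I : Type) (le : I -> I -> Prop) : set_system I :=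
  filter_from setT (fun i => [set j | le i j]).

(** This is [limf_esup a (tails le)], which is not available on index types
    that carry no [filteredType] structure. *)
Definition net_esup (I : Type) (le : I -> I -> Prop) (a : I -> \bar R) : \bar R :=
  ereal_inf [set ereal_sup (a @` V) | V in tails le].

(** Convergence in the weak-star topology is pointwise convergence on X. *)
Definition subdiff_hat d f x0 : set (topdual X) :=
  [set x0s | exists (I : Type) (le : I -> I -> Prop)
                    (x : I -> X) (xs : I -> topdual X),
    directed le /\ (forall i, d f (x i) (xs i)) /\
    [/\ x i @[i --> tails le] --> x0,
        f (x i) @[i --> tails le] --> f x0,
        {ptws, ((fun i => xs i : X -> R) @ tails le) --> (x0s : X -> R)} &
        net_esup le (fun i => (xs i (x i - x0)%R)%:E) <= 0]].

Definition convex phi := forall x y (t : R), (0 < t < 1)%R ->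
  phi ((1 - t) *: x + t *: y)%R <= (1 - t)%:E * phi x + t%:E * phi y.

Definition lipschitz_near phi x0 := exists2 V, nbhs x0 V &
  (forall x, V x -> phi x \is a fin_num) /\
  exists k : R, k.-lipschitz_V (fun x => fine (phi x) : R^o).

Definition separation_principle d := forall f phi x0,
  lsc f -> lsc phi -> convex phi -> lipschitz_near phi x0 -> dom f x0 ->
  (\forall x \near x0, f x0 + phi x0 <= f x + phi x) ->
  exists xs ys, [/\ subdiff_hat d f x0 xs, d phi x0 ys &
    forall v, (xs v + ys v = 0)%R].

Definition subdifferential d :=
  (forall f, proper f -> lsc f -> forall x,
     subdiff_MR f x `<=` d f x /\ d f x `<=` subdiff_C f x) /\
  separation_principle d.

Definition sds d g (Omega : set X) := forall u v,
  Omega u -> dom_subdiff d g u -> Omega v -> dom g v -> v <> u ->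
  let gamma (t : R) := g (u + t *: (v - u))%R in
  [/\ (forall t : R, (0 <= t <= 1)%R -> gamma t \is a fin_num) /\
        {within `[0%R, 1%R], continuous gamma},
      (forall t : R, (0 <= t < 1)%R -> exists2 l : \bar R, l < +oo &
         ((gamma (t + h)%R - gamma t) * (h^-1)%:E) @[h --> 0^'+] --> l) &
      (forall y (eps : R), segment_co u v y -> (0 < eps)%R ->
         exists2 r0 : R, (0 < r0 < 1)%R &
         forall (r : R) w, (0 < r <= r0)%R -> w = (y + r *: (v - u))%R ->
         forall (x : X^nat) (xs : nat -> topdual X) x0,
           (forall n, d g (x n) (xs n)) ->
           x n @[n --> \oo] --> x0 -> segment_co y w x0 ->
           limn_esup (fun n => (xs n (w - x n)%R)%:E) <=
             radial_subderivative g y (w - x0)%R + (eps * `|w - x0|)%:E)].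

(** Sequences in [dom f] converging to [x0]; being equal to [x0] is allowed. *)
Definition limsup_dom f x0 (F : X -> \bar R) : \bar R :=
  ereal_sup [set limn_esup (fun n => F (x n)) | x in
    [set x : X^nat | (forall n, dom f (x n)) /\ x n @[n --> \oo] --> x0]].

Definition strictly_upper_semismooth f x0 u := dom f x0 /\
  ereal_inf [set limsup_dom f x0
      (fun x => radial_subderivative f x (u + alpha *: (x0 - x))%R)
    | alpha in [set alpha : R | (0 <= alpha)%R]]
  <= radial_subderivative f x0 u.

End defs.

(* Main.v *)
Require Import Defs.
From mathcomp Require Import all_boot all_order all_algebra.
From mathcomp Require Import all_classical all_reals all_analysis.
From mathcomp Require Import ring lra.
Set Implicit Arguments.
Unset Strict Implicit.
Unset Printing Implicit Defensive.
Import Order.TTheory GRing.Theory Num.Theory.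
Import numFieldNormedType.Exports.
Local Open Scope classical_set_scope.
Local Open Scope ring_scope.

(* The key is a Zagrodny-type mean value theorem for the given subdifferential:
   if f a + k <= f b, there is c = a + th (b - a) in [a, b[ and (z, z* ) in the
   graph of the subdifferential, z arbitrarily close to c, with <z*, b - z>
   nearly at least k (1 - th) and <z*, b - a> nearly at least k.  It follows
   from Ekeland's principle applied to f plus the convex Lipschitz function
     phi x = min_{0 <= s <= 1} (t |x - (a + s (b - a))| - k s),  t large,
   and from the Separation Principle.  Consequently every l < f^r(x; w - x) is
   exceeded by some <z*, w - z> with z close to x.
   At y = xbar + t u, stability bounds the upper limits of such numbers
   <z*, w - z>, w = y + r u, by f^r(y; w - c) + eps |w - c|.  The mean value
   theorem on [y, w] then rules out f^r(y; u) = -oo, and since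
   w - x = r (u + (y - x) / r), upper semismoothness follows with
   alpha = 1 / r. *)

(** * Ekeland's variational principle and minima over compact sets *)

Lemma ereal_dense (R : realType) (x y : \bar R) :
  (x < y)%E -> exists2 q : R, (x < q%:E)%E & (q%:E < y)%E.
Proof.
case: x y => [x| |] [y| |] //.
- by rewrite lte_fin => xy; exists ((x + y) / 2); rewrite lte_fin; lra.
- by move=> _; exists (x + 1); rewrite ?ltry// lte_fin; lra.
- by move=> _; exists (y - 1); rewrite ?ltNyr// lte_fin; lra.
- by move=> _; exists 0; rewrite ?ltNyr ?ltry.
Qed.

(** A sequence of near-minimizers of [F] over successive sets [S] is Cauchy, and its limit cannot be
    improved. Closedness of the perturbed sublevel sets stands in for lower semicontinuity and
    allows a [D] that is not closed, such as a ball intersected with [dom f]. *)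
Lemma ekeland (R : realType) (X : completeNormedModType R) (D : set X)
    (F : X -> R) (e m : R) (c : X) :
  0 < e -> D c -> (forall x, D x -> m <= F x) ->
  (forall z r, closed [set x | D x /\ F x + e * `|x - z| <= r]) ->
  exists x, [/\ D x, F x + e * `|x - c| <= F c &
    forall y, D y -> F x <= F y + e * `|y - x|].
Proof.
move=> e0 Dc Fm Fcl.
pose S x := [set y | D y /\ F y + e * `|y - x| <= F x].
have Sxx x : D x -> S x x by move=> Dx; split => //; rewrite subrr normr0; lra.
have Strans x y z : S x y -> S y z -> S x z.
  move=> [_ xy] [Dz yz]; split => //.
  have := ler_normD (z - y) (y - x); rewrite subrKA => tri.
  have := ler_wpM2l (ltW e0) tri; lra.
(* The pair carries the step number, so that one choice function yields every [x n.+1], with error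
   1/(n+1). *)
have /choice[g gP] (p : nat * X) : exists y, D p.2 -> S p.2 y /\
    forall z, S p.2 z -> F y <= F z + p.1.+1%:R^-1.
  case: p => n x /=.
  have [Dx|nDx] := pselect (D x); last by exists x.
  have hi : has_inf (F @` S x).
    split; first by exists (F x), x => //; exact: Sxx.
    by exists m => _ [y [Dy _] <-]; exact: Fm.
  have n0 : 0 < n.+1%:R^-1 :> R by rewrite invr_gt0.
  have [_ [y Sy <-] yl] := inf_adherent n0 hi.
  exists y => _; split => // z Sz; apply/(le_trans (ltW yl)).
  rewrite lerD2r; apply: ge_inf; first exact: hi.2.
  by exists z.
pose x := fix x n := if n is n'.+1 then g (n', x n') else c.
have Dx n : D (x n).
  by elim: n => [//|n IH]; have [[]] := gP (n, x n) IH.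
have Sx n k : S (x n) (x (n + k)%N).
  elim: k => [|k IH]; first by rewrite addn0; exact: Sxx.
  by rewrite addnS; apply: Strans IH _; have [] := gP ((n + k)%N, x (n + k)%N) (Dx _).
have /cauchy_cvg xl : cauchy (x @ \oo).
  apply/cauchyP => eps eps0.
  have hi : has_inf (range (F \o x)).
    split; first by exists (F (x 0%N)), 0%N.
    by exists m => _ [n _ <-]; exact: Fm.
  (* Once [F (x n)] is within [e * eps] of the infimum, all later [x k] satisfy [e |x k - x n| <= F
     (x n) - F (x k) < e * eps]. *)
  have [_ [n _ <-] nl] := inf_adherent (mulr_gt0 e0 eps0) hi.
  exists (x n); exists n => // k /= nk.
  rewrite -(subnKC nk) -ball_normE /= distrC.
  have [_ h] := Sx n (k - n)%N.
  have := @ge_inf _ _ hi.2 (F (x (n + (k - n))%N)) (ex_intro2 _ _ _ I erefl).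
  rewrite -(ltr_pM2l e0); rewrite /= in nl; lra.
set l := lim (x @ \oo) in xl.
have Sl n : S (x n) l.
  apply: (closed_cvg (S (x n))) xl; first exact: Fcl.
  by exists n => // k /= nk; rewrite -(subnKC nk); exact: Sx.
exists l; split; [exact: (Sl 0%N).1|exact: (Sl 0%N).2|].
move=> y Dy; rewrite leNgt; apply/negP => ly.
(* A [y] violating the conclusion lies in every [S (x n)]; the vanishing errors then force
   [F l <= F y], against [ly]. *)
have Sy n : S (x n) y by apply: Strans (Sl n) _; split => //; exact: ltW.
have le0 : F l <= F y.
  apply/ler_addgt0Pr => eps eps0.
  have [n ne] : exists n, n.+1%:R^-1 < eps :> R.
    by have /ltr_add_invr[n] := eps0; rewrite add0r; exists n.
  have := (gP (n, x n) (Dx n)).2 _ (Sy n); rewrite /= -/(x n.+1).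
  have [_] := Sl n.+1; have := mulr_ge0 (ltW e0) (normr_ge0 (l - x n.+1)).
  move: ne; rewrite /= => /ltW ne h1 h2 h3.
  apply: le_trans (lerD (lexx _) ne); apply: le_trans h3; apply: le_trans h2.
  by rewrite lerDl.
have := mulr_ge0 (ltW e0) (normr_ge0 (y - l)); lra.
Qed.

(** The sets of points of [K] where [g < q], for [q] above the infimum, generate a proper filter,
    and a cluster point of it in [K] is a minimizer. An infimum [+oo] leaves no such [q] and is
    settled first. *)
Lemma lower_semicontinuous_min (R : realType) (T : topologicalType) (K : set T)
    (g : T -> \bar R) :
  compact K -> K !=set0 -> lower_semicontinuous g ->
  exists2 c, K c & forall x, K x -> (g c <= g x)%E.
Proof.
move=> cK [x0 Kx0] lg; set m := ereal_inf (g @` K).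
have [moo|] := eqVneq m +oo%E.
  exists x0 => // x Kx; apply: (@le_trans _ _ m); first by rewrite moo leey.
  by apply: ereal_inf_lbound; exists x.
rewrite -ltey => mlty.
have [Ag AK] : ProperFilter (filter_from [set q | (m < q)%E]
    (fun q => K `&` [set x | (g x < q)%E])) /\
    filter_from [set q | (m < q)%E] (fun q => K `&` [set x | (g x < q)%E]) K.
  split; last by exists +oo%E => // x [].
  apply: filter_from_proper.
    apply: filter_from_filter; first by exists +oo%E.
    move=> p q /= mp mq; exists (mine p q); first by rewrite /= lt_min mp.
    by move=> x [Kx] /=; rewrite lt_min => /andP[].
  by move=> q /= /ereal_inf_lt[_ [x Kx <-] xq]; exists x.
have [c [Kc cc]] := cK _ Ag AK.
exists c => // x Kx; apply: (@le_trans _ _ m); last first.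
  by apply: ereal_inf_lbound; exists x.
rewrite leNgt; apply/negP => mc.
have [q mq qc] : exists2 q : R, (m < q%:E)%E & (q%:E < g c)%E.
  exact: ereal_dense.
have [V Vc Vq] := lg _ _ qc.
have [||y [[_ /= yq] Vy]] := cc (K `&` [set x | (g x < q%:E)%E]) V.
- by exists q%:E.
- exact: Vc.
- by have := lt_trans yq (Vq _ Vy); rewrite ltxx.
Qed.

(** * Convex Lipschitz functions and a fuzzy sum rule *)

Definition convex_fun (R : realType) (X : normedModType R) (psi : X -> R) :=
  forall x y (t : R), 0 < t < 1 ->
  psi ((1 - t) *: x + t *: y) <= (1 - t) * psi x + t * psi y.

(** One inequality suffices, since [x] and [y] can be exchanged. [K] carries no sign, hence the
    factor [|K| + 1] in the estimates below. *)
Definition lipschitz_fun (R : realType) (X : normedModType R) (K : R)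
  (psi : X -> R) := forall x y, psi x <= psi y + K * `|x - y|.

Section convex_lipschitz.
Context (R : realType) (X : completeNormedModType R) (psi : X -> R) (K : R).
Hypotheses (cpsi : convex_fun psi) (lpsi : lipschitz_fun K psi).

Lemma lipschitz_fun_abs x y : `|psi x - psi y| <= K * `|x - y|.
Proof.
rewrite ler_norml; have := lpsi x y; have := lpsi y x.
by rewrite distrC => h1 h2; apply/andP; split; lra.
Qed.

Lemma lipschitz_fun_continuous : continuous psi.
Proof.
move=> x; apply/cvgrPdist_lt => e e0.
have K0 : 0 < `|K| + 1 by rewrite ltr_wpDl.
near=> y.
apply: (le_lt_trans (lipschitz_fun_abs _ _)).
apply: (@le_lt_trans _ _ ((`|K| + 1) * `|x - y|)).
  by apply: ler_wpM2r => //; apply: (le_trans (ler_norm K)); rewrite lerDl.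
rewrite -ltr_pdivlMl//; near: y.
apply: (@cvgr_dist_lt _ _ _ (nbhs x) _ id x) => //.
by rewrite mulr_gt0// invr_gt0.
Unshelve. all: by end_near. Qed.

Lemma lsc_EFin : lsc (EFin \o psi).
Proof.
split=> // x a /=; rewrite lte_fin => ax.
exists [set y | a < psi y]; last by move=> y /=; rewrite lte_fin.
exact: (cvgr_gt _ (@lipschitz_fun_continuous x) _ ax).
Qed.

Lemma convex_EFin : convex (EFin \o psi).
Proof. by move=> x y t t01; rewrite /= -!EFinM -EFinD lee_fin; exact: cpsi. Qed.

Lemma lipschitz_near_EFin x : lipschitz_near (EFin \o psi) x.
Proof.
exists setT; first exact: filterT.
split=> //; exists K => -[y z] _ /=; exact: lipschitz_fun_abs.
Qed.

Lemma convex_fun_quotient y v (t : R) : 0 < t <= 1 ->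
  (psi (y + t *: v) - psi y) * t^-1 <= psi (y + v) - psi y.
Proof.
move=> /andP[t0]; rewrite le_eqVlt => /predU1P[->|t1].
  by rewrite scale1r invr1 mulr1.
rewrite ler_pdivrMr//.
have := @cpsi y (y + v) t; rewrite t0 t1 => /(_ isT).
have -> : (1 - t) *: y + t *: (y + v) = y + t *: v.
  by rewrite scalerBl scale1r scalerDr addrA subrK.
lra.
Qed.

(** Clarke subgradients of [psi] are thus convex subgradients: convexity bounds the quotients with
    step at most 1 at a nearby [y] by [psi (y + v) - psi y], and the Lipschitz bound moves [y] to
    [x]. *)
Lemma subdiff_C_convex x (ys : topdual X) v :
  subdiff_C (EFin \o psi) x ys -> ys v <= psi (x + v) - psi x.
Proof.
move=> [_ /(_ v)]; rewrite -lee_fin => /le_trans; apply.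
apply: ge_ereal_sup => _ [delta /= delta0 <-].
apply/lee_addgt0Pr => e e0.
have K0 : 0 < 2 * (`|K| + 1) by rewrite mulr_gt0// ltr_wpDl.
rewrite limf_esupE; apply: ge_ereal_inf.
(* Passing from [y] to [x] costs at most [K |x - y|] twice, hence at most [e] when [|x - y| < r]. *)
pose r := e / (2 * (`|K| + 1)).
have r0 : 0 < r by rewrite divr_gt0.
exists (ereal_sup [set ereal_inf [set quotient (EFin \o psi) p.2 u' p.1
    | u' in ball v delta]
  | p in [set p : R * X | (0 < p.1 <= 1) && (`|x - p.2| < r)]]).
  exists [set p : R * X | (0 < p.1 <= 1) && (`|x - p.2| < r)] => //.
  exists ([set t : R | 0 < t <= 1], ball x r) => /=; last first.
    by move=> [t y] [/= t01]; rewrite -ball_normE /= t01.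
  split.
    near=> t; apply/andP; split; first by near: t; exact: nbhs_right_gt.
    by near: t; exact: nbhs_right_le.
  exists (ball x r `*` setT); last by move=> y [].
  exists (ball x r, setT) => //; split; last exact: filterT.
  exact: nbhsx_ballx.
apply: ge_ereal_sup => _ [[t y] /= /andP[t01 yr] <-].
apply: ge_ereal_inf; exists (quotient (EFin \o psi) y v t).
  by exists v => //; exact: ballxx.
rewrite /quotient /= -EFinB -EFinM lee_fin.
apply: (le_trans (convex_fun_quotient _ _ t01)).
have := lpsi (y + v) (x + v); have := lpsi x y.
have -> : y + v - (x + v) = y - x by rewrite opprD addrACA subrr addr0.
rewrite (distrC y x).
have : 2 * (K * `|x - y|) <= e.
  rewrite mulrA; apply: (@le_trans _ _ (2 * (`|K| + 1) * `|x - y|)).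
    apply: ler_wpM2r => //; apply: ler_wpM2l => //.
    by apply: (le_trans (ler_norm K)); rewrite lerDl.
  by rewrite -ler_pdivlMl// mulrC ltW.
lra.
Unshelve. all: by end_near. Qed.

(** The Separation Principle gives opposite functionals [xs] and [ys], with [ys] a convex
    subgradient of [psi] at [x]. A late enough member of the net for [xs] keeps the resulting bounds
    in two directions at once: one is measured from [z], as the mean value theorem requires, the
    other is a fixed vector. *)
Lemma fuzzy_sum_rule (d : subdiff_operator X) (f : X -> \bar R) (x : X) :
  subdifferential d -> lsc f -> dom f x ->
  (\forall y \near x, (f x + (psi x)%:E <= f y + (psi y)%:E)%E) ->
  forall v w e, 0 < e -> exists z zs, [/\ d f z zs, `|z - x| < e,
    psi x - psi (x + v) - e < zs (x + v - z) & psi x - psi (x + w) - e < zs w].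
Proof.
move=> [dMC dS] lf fx xmin v w e e0.
have [xs [ys [[I [le [z [zs P]]]] dys xsys]]] :=
  dS f (EFin \o psi) x lf lsc_EFin convex_EFin (lipschitz_near_EFin x) fx xmin.
move: P => [[[i0] le_refl le_trans le_dir] [dz [zx fzx zsxs esup]]].
have [_ /(_ _ dys) dysC] : (subdiff_MR (EFin \o psi) x `<=` d (EFin \o psi) x)
    /\ (d (EFin \o psi) x `<=` subdiff_C (EFin \o psi) x).
  by apply: dMC => //; [exists x; rewrite /dom /= ltry|exact: lsc_EFin].
have tF : Filter (tails le).
  apply: filter_from_filter; first by exists i0.
  move=> i j _ _; have [k [ik jk]] := le_dir i j.
  by exists k => // l /= kl; split; [exact: le_trans ik kl|exact: le_trans jk kl].
have tPF : ProperFilter (tails le).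
  by apply: filter_from_proper => i _; exists i; exact: le_refl.
have xsE u : xs u = - ys u by apply/eqP; rewrite -addr_eq0 xsys.
have zsu u (a : R) : a < xs u -> \forall i \near tails le, a < zs i u.
  move=> axs; have /pointwise_cvgP /(_ u) := zsxs.
  by move/cvgr_gt; exact.
have nearz : \forall i \near tails le, `|z i - x| < e.
  have /cvgrPdist_lt /(_ _ e0) := zx.
  by apply: filterS => i; rewrite distrC.
have near0 : \forall i \near tails le, zs i (z i - x) < e / 2.
  have : (net_esup le (fun i => (zs i (z i - x))%:E) < (e / 2)%:E)%E.
    by apply: le_lt_trans esup _; rewrite lte_fin divr_gt0.
  move=> /ereal_inf_lt[_ [V tV <-] Ve]; apply: filterS tV => i Vi.
  rewrite -lte_fin; apply: le_lt_trans Ve; apply: ereal_sup_ubound.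
  by exists i.
have nearv : \forall i \near tails le, psi x - psi (x + v) - e / 2 < zs i v.
  apply: zsu; rewrite xsE.
  have := subdiff_C_convex v dysC; lra.
have nearw : \forall i \near tails le, psi x - psi (x + w) - e < zs i w.
  apply: zsu; rewrite xsE.
  have := subdiff_C_convex w dysC; lra.
near (tails le) => i.
exists (z i), (zs i); split; [exact: dz| | |].
- by near: i.
(* Half of [e] pays for weak-star convergence at [v], the other half for replacing the base point
   [x] by [z i]. *)
- have -> : x + v - z i = v - (z i - x).
    by rewrite opprB addrCA addrA.
  rewrite linearB.
  have : zs i (z i - x) < e / 2 by near: i.
  have : psi x - psi (x + v) - e / 2 < zs i v by near: i.
  lra.
- by near: i.
Unshelve. all: by end_near. Qed.

End convex_lipschitz.

(** * The convex penalty attached to a segment *)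

Section segment_penalty.
Context (R : realType) (X : completeNormedModType R) (a b : X) (k t : R).

Definition segment_point (s : R) : X := a + s *: (b - a).

Definition penalty_at (x : X) (s : R) : R := t * `|x - segment_point s| - k * s.

(* The inf-convolution of t |.| with -k s on the segment; it does the work of
   a linear functional given by Hahn-Banach plus a multiple of the distance to
   [a, b]. *)
Definition segment_penalty (x : X) : R := inf [set penalty_at x s | s in `[0, 1]].

Lemma segment_point_continuous : continuous segment_point.
Proof.
by move=> s; apply: cvgD; [exact: cvg_cst|apply: cvgZr_tmp; exact: cvg_id].
Qed.

Lemma segment_point_convex s s' (l : R) :
  segment_point ((1 - l) * s + l * s') =
  (1 - l) *: segment_point s + l *: segment_point s'.
Proof.
rewrite /segment_point; move: (b - a) => v.
by rewrite !scalerDr !scalerA addrACA -!scalerDl subrK scale1r.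
Qed.

Lemma penalty_at_continuous x : continuous (penalty_at x).
Proof.
move=> s; apply: cvgB; apply: cvgM; [exact: cvg_cst| |exact: cvg_cst|exact: cvg_id].
apply: cvg_norm; apply: cvgB; first exact: cvg_cst.
exact: segment_point_continuous.
Qed.

Lemma penalty_at_min x : exists2 s : R, 0 <= s <= 1 &
  forall s', 0 <= s' <= 1 -> penalty_at x s <= penalty_at x s'.
Proof.
have [|s s01 smin] := @EVT_min _ (penalty_at x) _ _ (@ler01 R).
  by apply: continuous_subspaceT; exact: penalty_at_continuous.
by exists s; [move: s01; rewrite in_itv|move=> s' s'01; apply: smin; rewrite in_itv].
Qed.

Lemma segment_penalty_le x s : 0 <= s <= 1 -> segment_penalty x <= penalty_at x s.
Proof.
move=> s01; have [s0 _ s0min] := penalty_at_min x.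
apply: ge_inf; last by exists s => //=; rewrite in_itv.
exists (penalty_at x s0) => y [s' /=]; rewrite in_itv /= => s'01 <-.
exact: s0min.
Qed.

Lemma segment_penalty_attained x :
  exists2 s, 0 <= s <= 1 & segment_penalty x = penalty_at x s.
Proof.
have [s s01 smin] := penalty_at_min x; exists s => //.
apply/eqP; rewrite eq_le segment_penalty_le//=.
apply: lb_le_inf; first by exists (penalty_at x 0), 0 => //=; rewrite in_itv /= lexx ler01.
by move=> y [s' /=]; rewrite in_itv /= => s'01 <-; exact: smin.
Qed.

Hypothesis t0 : 0 <= t.

(** [penalty_at] is jointly convex in the point and the parameter, and minimizing over the parameter
    preserves convexity. *)
Lemma segment_penalty_convex : convex_fun segment_penalty.
Proof.
move=> x y l /andP[l0 l1].
have [s /andP[s0 s1] ->] := segment_penalty_attained x.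
have [s' /andP[s0' s1'] ->] := segment_penalty_attained y.
have l1' : 0 <= 1 - l by lra.
apply: (le_trans (@segment_penalty_le _ ((1 - l) * s + l * s') _)).
  by apply/andP; split; nra.
rewrite /penalty_at segment_point_convex opprD addrACA -!scalerBr.
have := ler_normD ((1 - l) *: (x - segment_point s)) (l *: (y - segment_point s')).
rewrite !normrZ (ger0_norm l1') (gtr0_norm l0) => /(ler_wpM2l t0).
lra.
Qed.

Lemma segment_penalty_lipschitz : lipschitz_fun t segment_penalty.
Proof.
move=> x y; have [s s01 ->] := segment_penalty_attained y.
apply: (le_trans (segment_penalty_le x s01)); rewrite /penalty_at.
have := ler_normD (x - y) (y - segment_point s); rewrite subrKA.
by move=> /(ler_wpM2l t0); lra.
Qed.

End segment_penalty.

(** * Near-minima along a segment and the approximate mean value theorem *)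

Lemma closed_lsc (R : realType) (X : completeNormedModType R) (f : X -> \bar R)
    (h : X -> R) :
  lsc f -> continuous h -> closed [set x | (f x <= (h x)%:E)%E].
Proof.
move=> [_ lf] ch.
have -> : [set x | (f x <= (h x)%:E)%E] = ~` [set x | ((h x)%:E < f x)%E].
  by apply/seteqP; split=> x /=; rewrite leNgt => /negP.
apply: open_closedC; rewrite openE /= => x /= /ereal_dense[q hq qf].
have [V Vx Vq] := lf _ _ qf.
have hx : \forall y \near x, h y < q by apply: (cvgr_lt _ (@ch x)).
rewrite /interior; apply: filterS2 Vx hx => y /Vq fy hy.
by apply: lt_trans fy; rewrite lte_fin.
Qed.

(** [th] minimizes [f (p s) - k s] over [0, 1]; excluding [th = 1] is what later allows division by
    [1 - th]-like quantities. *)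
Lemma segment_minimum (R : realType) (X : completeNormedModType R)
    (f : X -> \bar R) (a b : X) (k : R) :
  lsc f -> dom f a -> (f a + k%:E <= f b)%E ->
  exists (th fc : R), [/\ 0 <= th < 1, f (segment_point a b th) = fc%:E &
    forall s, 0 <= s <= 1 ->
      ((fc + k * (s - th))%:E <= f (segment_point a b s))%E].
Proof.
move=> lf fa fab; pose p := segment_point a b.
pose g s := (f (p s) - (k * s)%:E)%E.
have p0 : p 0 = a by rewrite /p /segment_point scale0r addr0.
have p1 : p 1 = b by rewrite /p /segment_point scale1r addrC subrK.
have lg : lower_semicontinuous g.
  move=> s r; rewrite /g lteBrDr// -EFinD => /ereal_dense[q rq qf].
  have [V Vx Vq] := lf.2 _ _ qf.
  have pV : \forall s' \near s, V (p s') := @segment_point_continuous _ _ a b s _ Vx.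
  have rs : \forall s' \near s, r + k * s' < q.
    have cs : (fun s' => r + k * s') @ s --> r + k * s.
      by apply: cvgD; [exact: cvg_cst|apply: cvgM; [exact: cvg_cst|exact: cvg_id]].
    exact: (cvgr_lt _ cs _ rq).
  exists [set s' | V (p s') /\ r + k * s' < q]; first exact: filterI.
  move=> s' [/Vq fs' rs']; rewrite lteBrDr// -EFinD.
  by apply: lt_trans fs'; rewrite lte_fin.
have [th th01 thmin] : exists2 th : R, 0 <= th < 1 &
    forall s, 0 <= s <= 1 -> (g th <= g s)%E.
  have [|c /=] := lower_semicontinuous_min (@segment_compact R 0 1) _ lg.
    by exists 0 => /=; rewrite in_itv /= lexx ler01.
  rewrite in_itv /= => /andP[c0 c1] cmin.
  have cmin' s : 0 <= s <= 1 -> (g c <= g s)%E.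
    by move=> s01; apply: cmin; rewrite /= in_itv.
  have [c1'|c1'] := ltP c 1; first by exists c => //; rewrite c0.
  have {c1 c1'} cE : c = 1 by apply/eqP; rewrite eq_le c1 c1'.
  (* A minimum at 1 is traded for 0: the assumption on [f b] says that [g 0 <= g 1]. *)
  exists 0; first by rewrite lexx ltr01.
  move=> s s01; apply: le_trans (cmin' _ s01).
  by rewrite cE /g p0 p1 mulr0 mulr1 sube0 leeBrDr.
have fth : f (p th) \is a fin_num.
  rewrite fin_numE lf.1 /= -ltey.
  have := thmin 0; rewrite lexx ler01 => /(_ isT).
  rewrite /g p0 mulr0 sube0 leeBlDr// => /le_lt_trans; apply.
  by rewrite lte_add_pinfty// ltry.
exists th, (fine (f (p th))); split=> //; first by rewrite fineK.
move=> s s01; have := thmin s s01; rewrite /g leeBrDr// -{1}(fineK fth) -EFinB -EFinD.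
congr (_ <= _)%E; congr EFin; lra.
Qed.

(** Lower semicontinuity gives the bound near each point of the segment; compactness of [0, 1] gives
    one [delta] for all of them. *)
Lemma segment_uniform_lower_bound (R : realType) (X : completeNormedModType R)
    (f : X -> \bar R) (a b : X) (k m eta : R) :
  lsc f -> 0 < eta ->
  (forall s, 0 <= s <= 1 -> ((m + k * s)%:E <= f (segment_point a b s))%E) ->
  \forall delta \near 0^'+, forall s x, 0 <= s <= 1 ->
    `|x - segment_point a b s| < delta -> ((m - eta + k * s)%:E <= f x)%E.
Proof.
move=> [_ lf] eta0 fm; pose p := segment_point a b.
have /compact_near_coveringP cov := @segment_compact R 0 1.
pose P (delta s : R) := forall x,
  `|x - p s| < delta -> ((m - eta + k * s)%:E <= f x)%E.
suff h (s : R) : (`[0, 1]%classic : set R) s -> \forall s' \near s & delta \near 0^'+, P delta s'.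
  near=> delta => s x s01.
  have cP : (`[0, 1]%classic : set R) `<=` P delta by near: delta; exact: (cov R 0^'+ P _ h).
  by apply: cP; rewrite /= in_itv.
rewrite /= in_itv /= => s01.
have sf : ((m - eta / 2 + k * s)%:E < f (p s))%E.
  by apply: lt_le_trans (fm _ s01); rewrite lte_fin; lra.
have [V /nbhs_ballP [r /= r0 rV] Vf] := lf _ _ sf.
have ps : \forall s' \near s, `|p s - p s'| < r / 2.
  have cs := @segment_point_continuous _ _ a b s.
  by have /cvgrPdist_lt := cs; apply; rewrite divr_gt0.
have ks : \forall s' \near s, k * s' < k * s + eta / 2.
  have cs : (fun s' => k * s') @ s --> k * s.
    by apply: cvgM; [exact: cvg_cst|exact: cvg_id].
  by apply: (cvgr_lt _ cs); rewrite ltrDl divr_gt0.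
near=> s' delta => x xd.
apply: (@le_trans _ _ (m - eta / 2 + k * s)%:E).
  have : k * s' < k * s + eta / 2 by near: s'.
  rewrite lee_fin; move: (k * s') (k * s) => u1 u2 u12. lra.
apply/ltW/Vf/rV; rewrite -ball_normE /=.
have tri := ler_distD (p s') (p s) x; rewrite (distrC (p s') x) in tri.
have dl : delta < r / 2 by near: delta; apply: nbhs_right_lt; rewrite divr_gt0.
have psl : `|p s - p s'| < r / 2 by near: s'.
apply: (le_lt_trans tri); rewrite [r]splitr; apply: ltrD => //.
exact: lt_trans dl.
Unshelve. all: by end_near. Qed.

Lemma segment_pointB (R : realType) (X : completeNormedModType R) (a b : X) (s s' : R) :
  segment_point a b s - segment_point a b s' = (s - s') *: (b - a).
Proof. by rewrite /segment_point opprD addrACA subrr add0r scalerBl. Qed.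

(** Ekeland's principle is applied to [f + phi] on a ball around [c] within [dom f]. A steep [phi]
    makes leaving the segment expensive, so [c] is nearly a minimizer. *)
Lemma perturbed_minimum (R : realType) (X : completeNormedModType R)
    (f : X -> \bar R) (a b : X) (k th fc e : R) :
  lsc f -> a != b -> 0 <= th < 1 -> f (segment_point a b th) = fc%:E ->
  (forall s, 0 <= s <= 1 ->
    ((fc + k * (s - th))%:E <= f (segment_point a b s))%E) ->
  0 < e -> exists t x s, let phi := segment_penalty a b k t in
    [/\ 0 <= t /\ dom f x, `|x - segment_point a b th| <= e,
      0 <= s <= 1 /\ `|s - th| <= e, phi x = penalty_at a b k t x s &
      \forall y \near x,
        (f x + (phi x)%:E <= f y + (phi y + e * `|y - x|)%:E)%E].
Proof.
move=> lf ab /andP[th0 th1] fth thmin e0; set c := segment_point a b th.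
have nb0 : 0 < `|b - a| by rewrite normr_gt0 subr_eq0 eq_sym.
have [r0 r0_gt0 fr0] : exists2 r : R, 0 < r &
    forall y, `|y - c| <= r -> ((fc - 1)%:E < f y)%E.
  have : ((fc - 1)%:E < f c)%E by rewrite fth lte_fin; lra.
  move=> /(lf.2 _ _)[V /nbhs_ballP [r /= r_gt0 rV] Vf].
  exists (r / 2); first by rewrite divr_gt0.
  move=> y yc; apply/Vf/rV; rewrite -ball_normE /= distrC.
  by apply: (le_lt_trans yc); lra.
(* The bound [r0 / 2] keeps [x] inside the ball, so that its minimality is local in the whole space;
   [e] bounds [|x - c|]; the third turns [|p(s) - c| <= 2 rho] into [|s - th| <= e]. *)
pose rho := Num.min (r0 / 2) (Num.min e (e * `|b - a| / 2)).
have rho0 : 0 < rho by rewrite /rho !lt_min !divr_gt0//= ?e0 ?mulr_gt0.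
have rho_r : rho <= r0 / 2 by rewrite /rho ge_min lexx.
have rho_e : rho <= e by rewrite /rho !ge_min lexx orbT.
have rho_b : rho <= e * `|b - a| / 2 by rewrite /rho !ge_min lexx !orbT.
pose m := fc - k * th; pose eta := Num.min 1 (e * rho).
have eta0 : 0 < eta by rewrite lt_min ltr01 mulr_gt0.
have eta1 : eta <= 1 by rewrite ge_min lexx.
have eta_e : eta <= e * rho by rewrite ge_min lexx orbT.
have mlow s : 0 <= s <= 1 -> ((m + k * s)%:E <= f (segment_point a b s))%E.
  by move=> /thmin; congr (_ <= _)%E; congr EFin; rewrite /m; ring.
have [delta [delta0 delta_rho deltaP]] : exists delta, [/\ 0 < delta,
    delta <= rho & forall s x, 0 <= s <= 1 ->
    `|x - segment_point a b s| < delta -> ((m - eta + k * s)%:E <= f x)%E].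
  have h := segment_uniform_lower_bound lf eta0 mlow.
  near (0 : R)^'+ => delta; exists delta; split.
  - by near: delta; exact: nbhs_right_gt.
  - by near: delta; exact: nbhs_right_le.
  - by near: delta.
(* At distance [delta] or more from [p(s)] the penalty [t |x - p(s)|] exceeds both possible gains
   together: 1 from [f] in the ball and [|k|] from [k (s - th)]. *)
pose t := (1 + 1 + `|k|) / delta.
have t0 : 0 < t by rewrite divr_gt0// ltr_wpDr.
have td : t * delta = 1 + 1 + `|k| by rewrite divfK// gt_eqF.
have kle s : 0 <= s <= 1 -> k * s - k * th <= `|k|.
  move=> /andP[s0 s1]; rewrite -mulrBr (le_trans (ler_norm _))// normrM.
  by rewrite ler_piMr// ler_norml; apply/andP; split; lra.
pose phi := segment_penalty a b k t.
pose D := [set x | `|x - c| <= r0 /\ dom f x].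
pose F x := fine (f x) + phi x.
have fE x : dom f x -> f x = (fine (f x))%:E.
  by move=> fx; rewrite fineK// fin_numE lf.1 -ltey.
have Dc : D c by split; [rewrite subrr normr0 ltW|rewrite /dom /= fth ltry].
have Fc : F c <= m.
  rewrite /F fth /= /m lerD2l.
  have th01 : 0 <= th <= 1 by rewrite th0 ltW.
  apply: (le_trans (segment_penalty_le _ _ _ _ _ th01)).
  by rewrite /penalty_at subrr normr0 mulr0 sub0r.
have Flow x : D x -> m - eta <= F x.
  move=> [xc fx]; rewrite /F.
  have [s s01 phix] := segment_penalty_attained a b k t x.
  rewrite [phi x]phix /penalty_at; have [sd|sd] := ltP `|x - segment_point a b s| delta.
    have := deltaP _ _ s01 sd; rewrite fE// lee_fin.
    have := mulr_ge0 (ltW t0) (normr_ge0 (x - segment_point a b s)); lra.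
  have := fr0 _ xc; rewrite fE// lte_fin.
  have := kle _ s01; have := ler_wpM2l (ltW t0) sd; rewrite td /m; lra.
have cphi : continuous phi.
  exact: (lipschitz_fun_continuous (@segment_penalty_lipschitz _ _ a b k t (ltW t0))).
have cdist (z : X) : continuous (fun x => `|x - z|).
  by move=> x; apply: cvg_norm; apply: cvgB; [exact: cvg_id|exact: cvg_cst].
have Fcl z r : closed [set x | D x /\ F x + e * `|x - z| <= r].
  (* The finite upper bound on [f x] already entails [dom f x], so the set is a closed ball
     intersected with a closed sublevel set. *)
  have -> : [set x | D x /\ F x + e * `|x - z| <= r] =
      [set x | ((`|x - c|)%:E <= r0%:E)%E] `&`
      [set x | (f x <= (r - phi x - e * `|x - z|)%:E)%E].
    apply/seteqP; split=> x /=.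
      move=> [[xc fx]]; rewrite /F => Fr; split; first by rewrite lee_fin.
      by rewrite fE// lee_fin; lra.
    rewrite lee_fin => -[xc fx].
    have dx : dom f x by apply: (le_lt_trans fx); rewrite ltry.
    by split; [split|]; move: fx => //; rewrite (fE _ dx) lee_fin /F; lra.
  apply: closedI.
    apply: (@closed_lsc _ _ (fun x => (`|x - c|)%:E) (fun _ => r0)) => //.
      split=> // x q; rewrite lte_fin => qx.
      exists [set y | q < `|y - c|]; last by move=> y; rewrite lte_fin.
      exact: (cvgr_gt _ (@cdist c x) _ qx).
    by move=> x; exact: cvg_cst.
  apply: closed_lsc => // x.
  apply: cvgB; first by apply: cvgB; [exact: cvg_cst|exact: cphi].
  by apply: cvgM; [exact: cvg_cst|exact: cdist].
have [x [[xr fx] xc xmin]] := ekeland e0 Dc Flow Fcl.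
have [s s01 phix] := segment_penalty_attained a b k t x.
(* Here [e |x - c| <= F c - F x <= eta <= e * rho]. *)
have xrho : `|x - c| <= rho.
  rewrite -(ler_pM2l e0); have := Flow x (conj xr fx); lra.
have sp : `|x - segment_point a b s| <= rho.
  apply: le_trans delta_rho; rewrite -(ler_pM2l t0) td.
  have := fr0 _ xr; rewrite fE// lte_fin.
  have := mulr_ge0 (ltW e0) (normr_ge0 (x - c)).
  have := kle _ s01; move: xc; rewrite /F [phi x]phix /penalty_at.
  move: Fc; rewrite /F /m; lra.
exists t, x, s => /=; split => //.
- by split => //; exact: ltW.
- exact: le_trans rho_e.
- split=> //; rewrite -(ler_pM2r nb0) -normrZ -segment_pointB.
  have := ler_distD x (segment_point a b s) c.
  rewrite (distrC _ x) -/c; lra.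
near=> y.
have [fy|] := ltP (f y) +oo%E; last first.
  by rewrite leye_eq => /eqP ->; rewrite addye ?leey// -ltNye ltNyr.
rewrite (fE x)// (fE y)// -!EFinD lee_fin.
have : F x <= F y + e * `|y - x|.
  apply: xmin; split => //.
  have yx : `|x - y| < r0 / 2.
    near: y; apply: (@cvgr_dist_lt _ _ _ (nbhs x) _ id x) => //.
    by rewrite divr_gt0.
  have := ler_distD x y c; rewrite (distrC y x); lra.
rewrite /F -/phi; lra.
Unshelve. all: by end_near. Qed.

Lemma topdualZ (R : realType) (X : normedModType R) (zs : topdual X) (l : R) x :
  zs (l *: x) = l * zs x.
Proof. by rewrite linearZ. Qed.

(** The fuzzy sum rule is applied at the perturbed minimum, in the direction [b - x] and in a
    direction parallel to the segment. [th] is fixed before [e], so the points [z] for all [e]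
    approach the same [c]. *)
Lemma approximate_mean_value (R : realType) (X : completeNormedModType R)
    (d : subdiff_operator X) (f : X -> \bar R) (a b : X) (k : R) :
  subdifferential d -> lsc f -> dom f a -> a != b -> (f a + k%:E <= f b)%E ->
  exists2 th, 0 <= th < 1 & forall e, 0 < e -> exists z zs,
    [/\ d f z zs, `|z - segment_point a b th| < e,
      k * (1 - th) - e < zs (b - z) & k - e < zs (b - a)].
Proof.
move=> sd lf fa ab fab.
have [th [fc [th01 fth thmin]]] := segment_minimum lf fa fab.
exists th => // e e0; set c := segment_point a b th.
pose N := `|k| + `|b - c| + `|b - a| + 1.
have N0 : 0 < N by rewrite ltr_wpDl// !addr_ge0.
(* The bound [(1 - th) / 2] ensures [s < 1]; [rho * N <= e / 2] absorbs the error [|k| rho] from [s]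
   against [th] and the slopes of [rho |y - x|]. *)
pose rho := Num.min (Num.min 1 (e / 2)) (Num.min ((1 - th) / 2) (e / 2 / N)).
have /andP[th0 th1] := th01.
have rho0 : 0 < rho by rewrite !lt_min ltr01 !divr_gt0//= subr_gt0.
have rho1 : rho <= 1 by rewrite !ge_min lexx.
have rho_e : rho <= e / 2 by rewrite !ge_min lexx orbT.
have rho_th : rho <= (1 - th) / 2 by rewrite !ge_min lexx !orbT.
have rho_N : rho * N <= e / 2.
  by rewrite -ler_pdivlMr// !ge_min lexx !orbT.
have [t [x [s [[t0 fx] xc [/andP[s0 s1] sth] phix xmin]]]] :=
  perturbed_minimum lf ab th01 fth thmin rho0.
have s_lt1 : s < 1.
  have := ler_norm (s - th); move: sth rho_th th1; lra.
have s1' : 0 < 1 - s by rewrite subr_gt0.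
pose psi y := segment_penalty a b k t y + rho * `|y - x|.
have cpsi : convex_fun psi.
  move=> y z l /andP[l0 l1]; rewrite /psi.
  have := @segment_penalty_convex R X a b k t t0 y z l.
  rewrite l0 l1 => /(_ isT).
  have -> : (1 - l) *: y + l *: z - x = (1 - l) *: (y - x) + l *: (z - x).
    by rewrite !scalerBr addrACA -opprD -scalerDl subrK scale1r.
  have := ler_normD ((1 - l) *: (y - x)) (l *: (z - x)).
  rewrite !normrZ (gtr0_norm l0) gtr0_norm ?subr_gt0// => /(ler_wpM2l (ltW rho0)).
  lra.
have lpsi : lipschitz_fun (t + rho) psi.
  move=> y z; rewrite /psi.
  have := @segment_penalty_lipschitz _ _ a b k t t0 y z.
  have := ler_normD (y - z) (z - x); rewrite subrKA => /(ler_wpM2l (ltW rho0)).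
  lra.
(* The bound in direction [w] is divided by [1 - s] at the end, so its error is scaled in
   advance. *)
pose zeta := e / 2 * (1 - s).
have zeta0 : 0 < zeta by rewrite mulr_gt0// divr_gt0.
have zeta_e : zeta <= e / 2.
  by rewrite ler_piMr// ?divr_ge0 ?(ltW e0)//; lra.
have min_psi : \forall y \near x, (f x + (psi x)%:E <= f y + (psi y)%:E)%E.
  by apply: filterS xmin => y; rewrite {1}/psi subrr normr0 mulr0 addr0.
(* Translation by [w] carries [p(s)] to [b] and keeps the offset [x - p(s)], so the penalty falls by
   at least [k (1 - s)]. *)
pose w := (1 - s) *: (b - a).
have [z [zs [dz zx zv zw]]] :=
  fuzzy_sum_rule cpsi lpsi sd lf fx min_psi (b - x) w zeta0.
have p1 : segment_point a b 1 = b by rewrite /segment_point scale1r addrC subrK.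
have psix : psi x = t * `|x - segment_point a b s| - k * s.
  by rewrite /psi subrr normr0 mulr0 addr0 phix.
have h01 : 0 <= (1 : R) <= 1 by rewrite ler01 lexx.
have psib : psi b <= - k + rho * `|b - x|.
  rewrite /psi lerD2r (le_trans (segment_penalty_le a b k t b h01))//.
  by rewrite /penalty_at p1 subrr normr0 mulr0 sub0r mulr1.
have psiw : psi (x + w) <= t * `|x - segment_point a b s| - k + rho * ((1 - s) * `|b - a|).
  rewrite /psi addrAC subrr add0r {2}/w normrZ (gtr0_norm s1') lerD2r.
  rewrite (le_trans (segment_penalty_le a b k t _ h01))//.
  rewrite /penalty_at mulr1 /w -segment_pointB -[x + _ - _]addrA.
  by rewrite [_ - _ - segment_point a b 1]addrAC subrr sub0r.
have tp := mulr_ge0 t0 (normr_ge0 (x - segment_point a b s)).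
have bx : `|b - x| <= `|b - c| + 1.
  have := ler_distD c b x; rewrite (distrC c x); move: xc rho1; rewrite -/c; lra.
have kth : k * (1 - th) - `|k| * rho <= k * (1 - s).
  have : k * (s - th) <= `|k| * rho.
    by rewrite (le_trans (ler_norm _))// normrM ler_wpM2l.
  lra.
exists z, zs; split => //.
- have := ler_distD x z c; move: zx xc zeta_e rho_e; rewrite -/c; lra.
- have zE : x + (b - x) = b by rewrite addrC subrK.
  move: zv; rewrite zE; apply: le_lt_trans.
  have := ler_wpM2l (ltW rho0) bx.
  have := mulr_ge0 (ltW rho0) (normr_ge0 (b - a)).
  move: rho_N; rewrite psix /N; lra.
- move: zw; rewrite topdualZ => zw.
  rewrite -(ltr_pM2l s1'); apply: le_lt_trans zw.
  have := mulr_ge0 (mulr_ge0 (ltW rho0) (normr_ge0 k)) (ltW s1').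
  have := mulr_ge0 (mulr_ge0 (ltW rho0) (normr_ge0 (b - c))) (ltW s1').
  have := mulr_ge0 (ltW rho0) (ltW s1').
  have := ler_wpM2r (ltW s1') rho_N.
  rewrite psix /zeta /N; move: psiw; lra.
Qed.

(** * Radial subderivatives and the subgradients they produce *)

Section radial_subderivative.
Context (R : realType) (X : completeNormedModType R) (f : X -> \bar R).

Lemma radial_subderivative_gt x u (l : \bar R) :
  (l < radial_subderivative f x u)%E ->
  \forall tau \near 0^'+, (l < quotient f x u tau)%E.
Proof.
rewrite /radial_subderivative limf_einfE => /ereal_sup_gt[_ [V V0 <-] lV].
apply: filterS V0 => tau Vtau; apply: lt_le_trans lV _.
by apply: ereal_inf_lbound; exists tau.
Qed.

Lemma radial_subderivative_ge x u (l : \bar R) :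
  (\forall tau \near 0^'+, (l <= quotient f x u tau)%E) ->
  (l <= radial_subderivative f x u)%E.
Proof.
move=> lq; rewrite /radial_subderivative limf_einfE; apply: le_ereal_sup_tmp.
exists (ereal_inf (quotient f x u @` [set tau | (l <= quotient f x u tau)%E])).
  by exists [set tau | (l <= quotient f x u tau)%E].
by apply: le_ereal_inf_tmp => _ [tau /= ltau <-].
Qed.

Lemma radial_subderivative_le x u (l : \bar R) :
  (\forall tau \near 0^'+, (quotient f x u tau <= l)%E) ->
  (radial_subderivative f x u <= l)%E.
Proof.
move=> ql; rewrite leNgt; apply/negP => /radial_subderivative_gt lq.
near (0 : R)^'+ => tau.
have : (l < quotient f x u tau)%E by near: tau.
by rewrite ltNge; apply/negP/negPn; near: tau.
Unshelve. all: by end_near. Qed.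

Lemma near0_right_scale (P : R -> Prop) (l : R) : 0 < l ->
  (\forall tau \near 0^'+, P tau) -> \forall tau \near 0^'+, P (l * tau).
Proof.
move=> l0 [r /= r0 rP]; near=> tau.
have tau0 : 0 < tau by near: tau; exact: nbhs_right_gt.
apply: rP => /=; last by rewrite mulr_gt0.
rewrite sub0r normrN gtr0_norm ?mulr_gt0// -ltr_pdivlMl//.
by near: tau; apply: nbhs_right_lt; rewrite mulr_gt0// invr_gt0.
Unshelve. all: by end_near. Qed.

Lemma radial_subderivativeZ_ge x u (l : R) : 0 < l ->
  (l%:E * radial_subderivative f x u <= radial_subderivative f x (l *: u))%E.
Proof.
move=> l0; rewrite leNgt; apply/negP => /ereal_dense[q qr].
rewrite -lte_pdivrMl// => /radial_subderivative_gt/(near0_right_scale l0) lq.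
have : (q%:E <= radial_subderivative f x (l *: u))%E.
  apply: radial_subderivative_ge; apply: filterS lq => tau.
  rewrite lte_pdivrMl// => /ltW /le_trans; apply.
  rewrite /quotient scalerA (mulrC tau) muleCA -EFinM invfM mulrA.
  by rewrite mulfV ?mul1r// gt_eqF.
by rewrite leNgt qr.
Qed.

Lemma radial_subderivativeZ x u (l : R) : 0 < l ->
  radial_subderivative f x (l *: u) = (l%:E * radial_subderivative f x u)%E.
Proof.
move=> l0; apply/eqP; rewrite eq_le radial_subderivativeZ_ge// andbT.
have li0 : 0 < l^-1 by rewrite invr_gt0.
rewrite -lee_pdivrMl//.
have := radial_subderivativeZ_ge x (l *: u) li0.
by rewrite scalerA mulVf ?gt_eqF// scale1r.
Qed.

Lemma radial_subderivative0 x : f x \is a fin_num -> radial_subderivative f x 0 = 0%E.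
Proof.
move=> fx; have q0 tau : quotient f x 0 tau = 0%E.
  by rewrite /quotient scaler0 addr0 subee// mul0e.
apply/eqP; rewrite eq_le; apply/andP; split.
  by apply: radial_subderivative_le; near=> tau; rewrite q0.
by apply: radial_subderivative_ge; near=> tau; rewrite q0.
Unshelve. all: by end_near. Qed.

End radial_subderivative.

(** The mean value theorem is used on the short segment from [x] to [b = x + tau (w - x)], where [f]
    rises by at least [tau q] with [l < q]. Its two bounds, on [b - z] and on [b - x], combine into
    one on [w - z]. *)
Lemma subderivative_subgradient (R : realType) (X : completeNormedModType R)
    (d : subdiff_operator X) (f : X -> \bar R) (x w : X) (l : R) :
  subdifferential d -> lsc f -> dom f x -> x != w ->
  (l%:E < radial_subderivative f x (w - x)%R)%E ->
  forall e, 0 < e -> exists z zs, [/\ d f z zs, `|z - x| < e & l < zs (w - z)].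
Proof.
move=> sd lf fx xw /ereal_dense[q]; rewrite lte_fin => lq qr e e0.
have wx0 : 0 < `|w - x| by rewrite normr_gt0 subr_eq0 eq_sym.
have q0 : 0 < `|q| + 1 by rewrite ltr_wpDl.
(* The third condition keeps [z] near [x]; the fourth makes the loss [q * th * tau] at most half of
   [q - l], the other half being left for [delta]. *)
have [tau [tau0 tau1 tau_e tau_q qtau]] : exists tau, [/\ 0 < tau, tau < 1,
    tau < e / 2 / `|w - x|, tau < (q - l) / 2 / (`|q| + 1) &
    (q%:E < quotient f x (w - x)%R tau)%E].
  near (0 : R)^'+ => tau; exists tau; split; near: tau.
  - exact: nbhs_right_gt.
  - exact: nbhs_right_lt.
  - by apply: nbhs_right_lt; rewrite !divr_gt0.
  - by apply: nbhs_right_lt; rewrite !divr_gt0// subr_gt0.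
  - exact: radial_subderivative_gt.
have fxE : f x = (fine (f x))%:E by rewrite fineK// fin_numE lf.1 -ltey.
pose b := x + tau *: (w - x).
have xb : x != b.
  by rewrite eq_sym -subr_eq0 addrAC subrr add0r scaler_eq0 gt_eqF//= subr_eq0 eq_sym.
have fb : (f x + (tau * q)%:E <= f b)%E.
  move: qtau; rewrite /quotient -/b fxE muleC lte_pdivlMl// -EFinM.
  by rewrite lteBrDr// addeC => /ltW.
have [th /andP[th0 th1] H] := approximate_mean_value sd lf fx xb fb.
pose delta := Num.min (e / 2) (tau * ((q - l) / 2)).
have delta0 : 0 < delta by rewrite lt_min !divr_gt0//= mulr_gt0// divr_gt0// subr_gt0.
have delta_e : delta <= e / 2 by rewrite ge_min lexx.
have delta_q : delta <= tau * ((q - l) / 2) by rewrite ge_min lexx orbT.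
have [z [zs [dz zc zb zbx]]] := H _ delta0.
exists z, zs; split => //.
  have := ler_distD (segment_point x b th) z x.
  have -> : `|segment_point x b th - x| = th * (tau * `|w - x|).
    rewrite /segment_point addrAC subrr add0r /b (addrAC x) subrr add0r.
    by rewrite !normrZ !ger0_norm// ltW.
  have : th * (tau * `|w - x|) <= tau * `|w - x|.
    by rewrite ler_piMl ?(ltW th1)// mulr_ge0// ltW.
  move: tau_e; rewrite ltr_pdivlMr//; lra.
rewrite -(ltr_pM2l tau0) -topdualZ.
have -> : tau *: (w - z) = tau *: (b - z) + (1 - tau) *: (b - x).
  rewrite /b (addrAC x _ (- x)) subrr add0r.
  rewrite -[w - z](subrKA x) scalerDr addrC.
  rewrite -[x + _ - z]addrAC [in RHS]scalerDr -addrA; congr (_ + _).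
  rewrite !scalerA -scalerDl; congr (_ *: _); ring.
rewrite linearD !topdualZ.
have tau1' : 0 < 1 - tau by rewrite subr_gt0.
have := ltr_pM2l tau0 (tau * q * (1 - th) - delta) (zs (b - z)); rewrite zb => h1.
have := ltr_pM2l tau1' (tau * q - delta) (zs (b - x)); rewrite zbx => h2.
have h3 : q * th * tau <= (q - l) / 2.
  move: tau_q; rewrite ltr_pdivlMr// => tq.
  apply: (@le_trans _ _ (tau * `|q|)); last by move: tau0 tq; lra.
  rewrite mulrC ler_wpM2l// ?(ltW tau0)// (le_trans (ler_norm _))// normrM.
  by rewrite (ger0_norm th0) ler_piMr// ltW.
have := ler_wpM2l (ltW tau0) h3.
move: h1 h2 delta_q => /idP h1 /idP h2; lra.
Unshelve. all: by end_near. Qed.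

(** * Upper limits of sequences *)

Section limn_esup_bounds.
Context (R : realType).
Implicit Types (v : (\bar R)^nat) (l : \bar R).

Lemma limn_esup_le v l : (forall n, v n <= l)%E -> (limn_esup v <= l)%E.
Proof.
move=> vl; rewrite /limn_esup limf_esupE; apply: ge_ereal_inf.
exists (ereal_sup (v @` setT)); first by exists setT => //; exact: filterT.
by apply: ge_ereal_sup => _ [n _ <-].
Qed.

Lemma limn_esup_ge v l : (forall n, l <= v n)%E -> (l <= limn_esup v)%E.
Proof.
move=> lv; rewrite /limn_esup limf_esupE; apply: le_ereal_inf_tmp => _ [V FV <-].
have [n Vn] := filter_ex FV.
by apply: le_ereal_sup_tmp; exists (v n) => //; exists n.
Qed.

Lemma limn_esup_gt v l (V : set nat) : (l < limn_esup v)%E -> (\oo V) ->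
  exists2 n, V n & (l < v n)%E.
Proof.
rewrite /limn_esup limf_esupE => lv FV.
have /ereal_sup_gt[_ [n Vn <-] ln] : (l < ereal_sup (v @` V))%E.
  by apply: (lt_le_trans lv); apply: ereal_inf_lbound; exists V.
by exists n.
Qed.

End limn_esup_bounds.

Lemma cvg_harmonic_dist (R : realType) (X : normedModType R) (z : X^nat) (c : X) :
  (forall n, `|z n - c| < n.+1%:R^-1) -> z n @[n --> \oo] --> c.
Proof.
move=> zc; apply/cvgrPdist_lt => e e0.
have /cvgrPdist_lt /(_ e e0) := @cvg_harmonic R.
apply: filterS => n; rewrite sub0r normrN distrC => h.
by apply: (lt_trans (zc n)); apply: le_lt_trans h; rewrite ler_norm.
Qed.

Lemma segment_coE (R : realType) (X : completeNormedModType R) (a b : X) (s : R) :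
  0 <= s < 1 -> segment_co a b (segment_point a b s).
Proof. by move=> s01; exists s => //=; rewrite in_itv. Qed.

(** * Consequences of stability at a single point *)

Section sds_at_point.
Context (R : realType) (X : completeNormedModType R) (d : subdiff_operator X)
  (f : X -> \bar R) (y u : X).
Hypotheses (sd : subdifferential d) (lf : lsc f) (u0 : u != 0)
  (fy : f y \is a fin_num).

(* Condition (iii) of directional stability at a fixed point, in direction [u]. *)
Let stable := forall eps, 0 < eps -> exists2 r0 : R, 0 < r0 < 1 &
  forall (r : R) w, 0 < r <= r0 -> w = y + r *: u ->
  forall (x : X^nat) (xs : nat -> topdual X) x0,
    (forall n, d f (x n) (xs n)) -> x n @[n --> \oo] --> x0 ->
    segment_co y w x0 ->
    (limn_esup (fun n => (xs n (w - x n)%R)%:E) <=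
      radial_subderivative f y (w - x0)%R + (eps * `|w - x0|)%:E)%E.

(** If the subderivative were [-oo], stability would force the numbers [<zs, w - z>] to have upper
    limit [-oo], whereas the mean value theorem on [y, w], with [f w] finite, bounds them from
    below. *)
Lemma stable_radial_subderivative_gtNy (r1 : R) : stable -> 0 < r1 ->
  (forall r, 0 < r <= r1 -> f (y + r *: u) \is a fin_num) ->
  (-oo < radial_subderivative f y u)%E.
Proof.
move=> /(_ 1 ltr01)[r0 /andP[r0_gt0 _] H] r1_gt0 fin.
rewrite ltNge leeNy_eq; apply/negP => /eqP fNy.
pose r := Num.min r0 r1; have r_gt0 : 0 < r by rewrite lt_min r0_gt0.
have rr0 : 0 < r <= r0 by rewrite r_gt0 ge_min lexx.
have rr1 : 0 < r <= r1 by rewrite r_gt0 ge_min lexx orbT.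
pose w := y + r *: u; have fw := fin _ rr1.
have wy : w - y = r *: u by rewrite /w addrAC subrr add0r.
have yw : y != w by rewrite eq_sym -subr_eq0 wy scaler_eq0 negb_or u0 gt_eqF.
pose k := fine (f w) - fine (f y).
have fyw : (f y + k%:E <= f w)%E.
  by rewrite -(fineK fy) -[leRHS](fineK fw) -EFinD /k addrC subrK.
have dfy : dom f y by rewrite /dom /= ltey_eq fy.
have [th th01 mv] := approximate_mean_value sd lf dfy yw fyw.
have /choice[p pP] (n : nat) : exists p : X * topdual X, [/\ d f p.1 p.2,
    `|p.1 - segment_point y w th| < n.+1%:R^-1 &
    k * (1 - th) - 1 <= p.2 (w - p.1)].
  have n0 : 0 < n.+1%:R^-1 :> R by rewrite invr_gt0.
  have [z [zs [dz zc zw _]]] := mv _ n0.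
  exists (z, zs); split => //=; apply/ltW; apply: le_lt_trans zw.
  by rewrite lerB// invf_le1// ler1n.
have := H r w rr0 erefl (fun n => (p n).1) (fun n => (p n).2) _
  (fun n => let: And3 h _ _ := pP n in h)
  (cvg_harmonic_dist (fun n => let: And3 _ h _ := pP n in h)) (segment_coE _ _ th01).
have -> : w - segment_point y w th = ((1 - th) * r) *: u.
  rewrite -{1}[w](_ : segment_point y w 1 = w); last first.
    by rewrite /segment_point scale1r addrC subrK.
  by rewrite segment_pointB wy scalerA.
(* Since [th < 1], the direction [w - c] is a positive multiple of [u], and homogeneity transfers
   the value [-oo] to it. *)
have [_ th1] := andP th01.
have l0 : 0 < (1 - th) * r by rewrite mulr_gt0// subr_gt0.
rewrite radial_subderivativeZ// fNy gt0_muleNy ?lte_fin// addNye leeNy_eq => /eqP E.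
have : ((k * (1 - th) - 1)%:E <= limn_esup (fun n => ((p n).2 (w - (p n).1))%:E))%E.
  by apply: limn_esup_ge => n; rewrite lee_fin; have [] := pP n.
by rewrite E.
Qed.

(** A value [l] strictly between the two sides would give subgradients at points tending to [y] with
    [<zs, w - z> > r l]; stability with limit point [y] itself contradicts this after division by
    [r]. *)
Lemma stable_strictly_upper_semismooth : stable ->
  radial_subderivative f y u \is a fin_num -> strictly_upper_semismooth f y u.
Proof.
move=> st fin; split; first by rewrite /dom /= ltey_eq fy.
have nu0 : 0 < `|u| by rewrite normr_gt0.
apply/lee_addgt0Pr => eps eps0.
(* As [|w - y| = r |u|], the error [eps / |u|] becomes [r * eps]. *)
have [r /andP[r_gt0 r_lt1] H] := st (eps / `|u|) (divr_gt0 eps0 nu0).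
apply: ge_ereal_inf.
exists (limsup_dom f y (fun x => radial_subderivative f x (u + r^-1 *: (y - x)))).
  by exists r^-1 => //=; rewrite invr_ge0 ltW.
apply: ge_ereal_sup => _ [x [domx xy] <-].
rewrite leNgt; apply/negP => /ereal_dense[l rho_l lx].
pose w := y + r *: u; have wy : w - y = r *: u by rewrite /w addrAC subrr add0r.
have nwy : `|w - y| = r * `|u| by rewrite wy normrZ gtr0_norm.
have /choice[p pP] (n : nat) : exists p : X * topdual X,
    [/\ d f p.1 p.2, `|p.1 - y| < n.+1%:R^-1 & r * l < p.2 (w - p.1)].
  have n0 : 0 < n.+1%:R^-1 / 2 :> R by rewrite divr_gt0// invr_gt0.
  have ru0 : 0 < r * `|u| by rewrite mulr_gt0.
  have xn : \forall m \near \oo, `|y - x m| < n.+1%:R^-1 / 2.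
    by have /cvgrPdist_lt := xy; apply.
  (* Being closer to [y] than [w] is, [x m] differs from [w]. *)
  have xr : \forall m \near \oo, `|y - x m| < r * `|u|.
    by have /cvgrPdist_lt := xy; apply.
  have [m [xmn xmr] lm] := limn_esup_gt lx (filterI xn xr).
  have xmw : x m != w.
    by apply: contraTneq xmr => ->; rewrite distrC nwy ltxx.
  have wxE : w - x m = r *: (u + r^-1 *: (y - x m)).
    by rewrite scalerDr scalerA mulfV ?gt_eqF// scale1r /w -addrA addrCA.
  have rl : ((r * l)%:E < radial_subderivative f (x m) (w - x m)%R)%E.
    by rewrite wxE radial_subderivativeZ// EFinM lte_pmul2l// lte_fin.
  have [z [zs [dz zx zl]]] :=
    subderivative_subgradient sd lf (domx m) xmw rl n0.
  exists (z, zs); split => //=.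
  by apply: (le_lt_trans (ler_distD (x m) _ _)); rewrite [ltRHS]splitr ltrD// distrC.
have rr : 0 < r <= r by rewrite r_gt0 lexx.
have wyy : segment_co y w y.
  by exists 0; rewrite /= ?in_itv/= ?lexx ?ltr01// scale0r addr0.
have := H r w rr erefl (fun n => (p n).1) (fun n => (p n).2) y
  (fun n => let: And3 h _ _ := pP n in h)
  (cvg_harmonic_dist (fun n => let: And3 _ h _ := pP n in h)) wyy.
rewrite nwy wy radial_subderivativeZ// -(fineK fin) -EFinM -EFinD => Hle.
have : ((r * l)%:E <= limn_esup (fun n => ((p n).2 (w - (p n).1))%:E))%E.
  by apply: limn_esup_ge => n; rewrite lee_fin; have [_ _ /ltW] := pP n.
move=> /le_trans/(_ Hle); rewrite lee_fin.
have -> : eps / `|u| * (r * `|u|) = r * eps by rewrite mulrCA divfK// gt_eqF.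
rewrite -mulrDr ler_pM2l// leNgt.
by move: rho_l; rewrite -(fineK fin) -EFinD lte_fin => ->.
Qed.

End sds_at_point.

Unset Implicit Arguments.

Theorem proposition8 (R : realType) (X : completeNormedModType R)
    (d : subdiff_operator X) (Omega : set X) (f : X -> \bar R) :
  subdifferential d ->
  Omega !=set0 -> open Omega -> convex_set (Omega : set (convex_lmodType X)) ->
  lsc f -> Omega `&` dom f !=set0 ->
  sds d f Omega ->
  forall (xbar u : X) (t : R),
    Omega xbar -> dom_subdiff d f xbar ->
    Omega (xbar + u) -> dom f (xbar + u) ->
    0 <= t < 1 ->
    strictly_upper_semismooth f (xbar + t *: u) u /\
    radial_subderivative f (xbar + t *: u) u \is a fin_num.
Proof.
move=> sd _ _ _ lf _ sdsf xbar u t Oxbar dxbar Oxu fxu /andP[t0 t1].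
(* Stability speaks of distinct endpoints only. For [u = 0] all subderivatives in play vanish, with
   [alpha = 0]. *)
have [u_eq0|u0] := eqVneq u 0.
  move: fxu; rewrite u_eq0 scaler0 addr0 => fx.
  have fin x : dom f x -> f x \is a fin_num.
    by move=> dfx; rewrite fin_numE lf.1 -ltey.
  have rad0 x : dom f x -> radial_subderivative f x 0 = 0%E.
    by move=> /fin; exact: radial_subderivative0.
  rewrite rad0//; split => //; split => //; rewrite rad0//.
  apply: ge_ereal_inf.
  exists (limsup_dom f xbar (fun x => radial_subderivative f x (0 + 0 *: (xbar - x)))).
    by exists 0; rewrite /= ?lexx.
  apply: ge_ereal_sup => _ [x [domx _] <-]; apply: limn_esup_le => n.
  by rewrite scale0r addr0 rad0.
have uE : xbar + u - xbar = u by rewrite addrAC subrr add0r.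
have xuN : xbar + u <> xbar by move=> E; move/eqP: u0; apply; rewrite -uE E subrr.
have := sdsf xbar (xbar + u) Oxbar dxbar Oxu fxu xuN.
rewrite uE => -[[fin _] deriv st].
set y := xbar + t *: u.
have fy : f y \is a fin_num by apply: fin; rewrite t0 ltW.
have yseg : segment_co xbar (xbar + u) y.
  by exists t; [rewrite /= in_itv /= t0|rewrite uE].
have sty eps : 0 < eps -> _ := st y eps yseg.
have fin1 r : 0 < r <= 1 - t -> f (y + r *: u) \is a fin_num.
  move=> /andP[r0 r1]; rewrite /y -addrA -scalerDl; apply: fin.
  by apply/andP; split; lra.
(* The quotients of [f] at [y] in direction [u] are those of [gamma] at [t], whose limit is the
   right derivative, below [+oo]. *)
have lty : (radial_subderivative f y u < +oo)%E.
  have [|l l_lty lim] := deriv t; first by rewrite t0.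
  have [q lq _] := ereal_dense l_lty.
  apply: (@le_lt_trans _ _ q%:E); last exact: ltry.
  apply: radial_subderivative_le.
  have lq_nbhs : nbhs l [set z | (z < q%:E)%E].
    exact: (@open_ereal_lt_ereal _ _ l lq).
  have lim_lt := lim _ lq_nbhs.
  near=> h; apply: ltW; rewrite /quotient /y -addrA -scalerDl.
  by near: h; exact: lim_lt.
have gtNy : (-oo < radial_subderivative f y u)%E.
  by apply: (stable_radial_subderivative_gtNy sd lf u0 fy sty _ fin1); rewrite subr_gt0.
have rfin : radial_subderivative f y u \is a fin_num.
  by rewrite fin_numE -ltNye -ltey gtNy.
split=> //; exact: (stable_strictly_upper_semismooth sd lf u0 fy sty).
Unshelve. all: by end_near. Qed.
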